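(* Let $d=3$ and let $(\mathcal V,w)$ be a lattice in $\mathbf R^3$ such that the support of $X_\alpha$ is in $\{-1,0,1\}$ for every $\alpha\in\{1,2,3\}$. Suppose that for any pairwise distinct $\alpha,\beta,\gamma\in\{1,2,3\}$ there exist constants $c\in[0,\frac1{72}]$ and $c_\alpha,c_\beta,c_\gamma\in[-\frac1{72},\frac1{72}]$ such that (i) $P(X_\alpha=0)=\frac23$ and $P(X_\alpha=1)=P(X_\alpha=-1)=\frac16$; (ii) $P(X_\alpha=X_\beta=0)=\frac49$; (iii) $P(X_\alpha=\sigma_\alpha,X_\beta=0)=\frac19$ for $\sigma_\alpha\in\{-1,1\}$; (iv) $P(X_\alpha=\sigma_\alpha,X_\beta=\sigma_\beta)=\frac1{36}$ for $\sigma_\alpha,\sigma_\beta\in\{-1,1\}$; (v) $P(X_\alpha=X_\beta=X_\gamma=0)=\frac13-8c$; (vi) $P(X_\alpha=\sigma_\alpha,X_\beta=X_\gamma=0)=\frac1{18}+4c+4\sigma_\alpha c_\alpha$ for $\sigma_\alpha\in\{-1,1\}$; (vii) $P(X_\alpha=\sigma_\alpha,X_\beta=\sigma_\beta,X_\gamma=0)=\frac1{36}-2c-2\sigma_\alpha c_\alpha-2\sigma_\beta c_\beta$ for $\sigma_\alpha,\sigma_\beta\in\{-1,1\}$; (viii) $P(X_\alpha=\sigma_\alpha,X_\beta=\sigma_\beta,X_\gamma=\sigma_\gamma)=c+\sigma_\alpha c_\alpha+\sigma_\beta c_\beta+\sigma_\gamma c_\gamma$ for $\sigma_\alpha,\sigma_\beta,\sigma_\gamma\in\{-1,1\}$.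 Then $(\mathcal V,w)$ is isotropic with speed of sound $c_s=3^{-1/2}$.
   Context: A lattice in $\mathbf R^d$ is a pair $(\mathcal V,w)$ where $\mathcal V=\{v_0=0,v_1,\dots,v_n\}\subset\mathbf R^d$ is a set of pairwise distinct velocities ($n\in\mathbf N$) and $w=(w_0,\dots,w_n)$ is a vector of strictly positive weights. It is isotropic with speed of sound $c_s>0$ if for all indices $\alpha,\beta,\gamma,\zeta\in\{1,\dots,d\}$ ($v_{i,\alpha}$ is the $\alpha$-component of $v_i$): $\sum_i w_i=1$, $\sum_i w_iv_{i,\alpha}=0$, $\sum_i w_iv_{i,\alpha}v_{i,\beta}=c_s^2\delta_{\alpha\beta}$, $\sum_i w_iv_{i,\alpha}v_{i,\beta}v_{i,\gamma}=0$, $\sum_i w_iv_{i,\alpha}v_{i,\beta}v_{i,\gamma}v_{i,\zeta}=c_s^4(\delta_{\alpha\beta}\delta_{\gamma\zeta}+\delta_{\alpha\gamma}\delta_{\beta\zeta}+\delta_{\alpha\zeta}\delta_{\beta\gamma})$. To a lattice one associates the measure $P$ on $\{0,1,\dots,n\}$ with $P(\{i\})=w_i$ and the functions $X_\alpha(i)=v_{i,\alpha}$, $\alpha\in\{1,\dots,d\}$. ''The support of $X_\alpha$ is in $S$'' means $v_{i,\alpha}\in S$ for all $i$. *)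

(* Defs.v *)
From mathcomp Require Import all_boot all_order all_algebra.
From mathcomp Require Import reals.

Set Implicit Arguments.
Unset Strict Implicit.
Unset Printing Implicit Defensive.

Import Order.TTheory GRing.Theory Num.Theory.
Local Open Scope ring_scope.

(* The velocities v_0, ..., v_n are indexed by 'I_n.+1; v_0 is [vel ord0]. *)
Record lattice (R : realType) (d : nat) := Lattice {
  lat_n : nat;
  vel : 'I_lat_n.+1 -> 'rV[R]_d;
  weight : 'I_lat_n.+1 -> R;
  vel0 : vel ord0 = 0;
  vel_inj : injective vel;
  weight_gt0 : forall i, 0 < weight i
}.

Arguments vel {R d} l _.
Arguments weight {R d} l _.

(* X_a(i) = v_{i,a} *)
Definition vcoord (R : realType) (d : nat) (L : lattice R d) (a : 'I_d)
  (i : 'I_(lat_n L).+1) : R := vel L i 0 a.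
Arguments vcoord {R d} L a i.

(* The measure on {0, ..., n} with mass w_i at i; that its total mass is 1 is
   part of isotropy, not of the definition of a lattice. *)
Definition prob (R : realType) (d : nat) (L : lattice R d)
  (A : {set 'I_(lat_n L).+1}) : R := \sum_(i in A) weight L i.
Arguments prob {R d} L A.

Definition kron (R : realType) (d : nat) (a b : 'I_d) : R := (a == b)%:R.
Arguments kron R {d} a b.

Definition isotropic (R : realType) (d : nat) (L : lattice R d) (cs : R) :
  Prop :=
  let w := weight L in
  let X := vcoord L in
  let delta := @kron R d in
  0 < cs /\
  \sum_i w i = 1 /\
  (forall a, \sum_i w i * X a i = 0) /\
  (forall a b, \sum_i w i * X a i * X b i = cs ^+ 2 * delta a b) /\
  (forall a b g, \sum_i w i * X a i * X b i * X g i = 0) /\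
  (forall a b g z,
     \sum_i w i * X a i * X b i * X g i * X z i
     = cs ^+ 4 * (delta a b * delta g z + delta a g * delta b z
                  + delta a z * delta b g)).

(* Main.v *)
Require Import Defs.
From mathcomp Require Import all_boot all_order all_algebra.
From mathcomp Require Import reals ring lra zify.

(** Since (X_0, X_1, X_2) takes values in {-1,0,1}^3, a mixed moment with all
    exponents positive is a sum over sign patterns of the joint law, so each
    moment only involves the joint law of the coordinates that occur in it.
    Moments in at most two coordinates factorize, as for independent
    coordinates, with moments 1, 0, 1/3, 0, 1/3 in degrees 0, ..., 4.  Those in
    three coordinates and of degree at most 4 have at least two odd exponents,
    which cancels the constants c and c_a in the law (viii), so they vanish like
    the corresponding products. *)

Set Implicit Arguments.
Unset Strict Implicit.
Unset Printing Implicit Defensive.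

Import Order.TTheory GRing.Theory Num.Theory.
Local Open Scope ring_scope.

Lemma sum_fibers (R : nzRingType) (I : finType) (A : pred I) (X W : I -> R)
    (S : seq R) (f : R -> R) :
  uniq S -> (forall i, X i \in S) ->
  \sum_(i | A i) W i * f (X i)
  = \sum_(s <- S) (\sum_(i | A i && (X i == s)) W i) * f s.
Proof.
move=> uS XS.
under [RHS]eq_bigr do rewrite mulr_suml.
rewrite (exchange_big_dep A) /=; last by move=> s i _ /andP[].
apply: eq_bigr => i Ai; rewrite (eq_bigl (pred1 (X i))) => [|s].
  by rewrite -big_filter filter_pred1_uniq // big_seq1.
by rewrite Ai eq_sym.
Qed.

Lemma uniq_signs (R : numDomainType) : uniq [:: -1; 0; 1 : R].
Proof.
by rewrite /= !inE oppr_eq0 eqNr (eq_sym 0) !oner_eq0.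
Qed.

(** A positive exponent kills the fiber over 0, so only the signs remain. Since [A] and [W] are
    arbitrary, the lemma can be iterated, conditioning on one coordinate at a time. *)
Lemma sum_fibersX (R : numDomainType) (I : finType) (A : pred I) (X W : I -> R)
    (k : nat) :
  (forall i, X i \in [:: -1; 0; 1]) ->
  \sum_(i | A i) W i * X i ^+ k.+1
  = (\sum_(i | A i && (X i == -1)) W i) * (-1) ^+ k.+1
    + \sum_(i | A i && (X i == 1)) W i.
Proof.
move=> XS; rewrite (sum_fibers _ _ (fun x => x ^+ k.+1) (uniq_signs R) XS).
by rewrite !big_cons big_nil /= expr0n /= expr1n mulr1 mulr0 add0r addr0.
Qed.

(* The k-th moment of the common law of the coordinates. *)
Definition moment (R : realType) (k : nat) : R :=
  if k is 0%N then 1 else (1 + (-1) ^+ k) / 6.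

Lemma prodrX_count (R : comNzRingType) (T : finType) (F : T -> R) (s : seq T) :
  \prod_(x <- s) F x = \prod_x F x ^+ count_mem x s.
Proof.
elim: s => [|x s IHs]; first by rewrite big_nil big1.
rewrite big_cons IHs /=; under [RHS]eq_bigr do rewrite exprD.
rewrite big_split /=; congr (_ * _).
rewrite (bigD1 x) //= eqxx expr1 big1 ?mulr1 // => y /negPf.
by rewrite eq_sym => ->.
Qed.

Section Moments.
Variables (R : realType) (d : nat) (L : lattice R d).
Hypothesis supp : forall a i, vcoord L a i \in [:: -1; 0; 1].
Local Notation X := (vcoord L).
Local Notation w := (weight L).

Lemma probE (A : pred 'I_(lat_n L).+1) (p : R) :
  prob L [set i | A i] = p -> \sum_(i | A i) w i = p.
Proof. by move<-; apply: eq_bigl => i; rewrite inE. Qed.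

Lemma total_mass (a : 'I_d) :
  prob L [set i | X a i == 0] = 2 / 3 ->
  prob L [set i | X a i == 1] = 1 / 6 ->
  prob L [set i | X a i == -1] = 1 / 6 ->
  \sum_i w i = 1.
Proof.
move=> /probE p0 /probE p1 /probE pN.
under eq_bigr do rewrite -[w _]mulr1.
rewrite (sum_fibers _ _ (fun=> 1) (uniq_signs R) (supp a)).
rewrite !big_cons big_nil /= p0 p1 pN; lra.
Qed.

Lemma moment1 (a : 'I_d) (p : nat) :
  prob L [set i | X a i == 1] = 1 / 6 ->
  prob L [set i | X a i == -1] = 1 / 6 ->
  \sum_i w i * X a i ^+ p.+1 = moment R p.+1.
Proof.
by move=> /probE p1 /probE pN; rewrite sum_fibersX //= p1 pN /moment; ring.
Qed.

(** By (iv) every sign pair has mass 1/36 = 1/6 * 1/6, so the sum over sign patterns splits into a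
    product. *)
Lemma moment2 (a b : 'I_d) (p q : nat) :
  (forall s t : R, s \in [:: -1; 1] -> t \in [:: -1; 1] ->
     prob L [set i | (X a i == s) && (X b i == t)] = 1 / 36) ->
  \sum_i w i * X a i ^+ p.+1 * X b i ^+ q.+1 = moment R p.+1 * moment R q.+1.
Proof.
move=> law; rewrite !sum_fibersX //=.
have law' s t : s \in [:: -1; 1] -> t \in [:: -1; 1] ->
    \sum_(i | (X b i == t) && (X a i == s)) w i = 1 / 36.
  by move=> ss tt; apply: probE; rewrite -(law s t) //; congr prob;
     apply/setP => i; rewrite !inE andbC.
by rewrite !law' ?inE ?eqxx ?orbT // /moment; field.
Qed.

(** The exponents are shifted by one, so the bound on [p + q + r] means degree at most 4: at most
    one exponent is 2, the others are 1. A term of the law contains at most one sign, so some sign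
    keeps an odd power and sums to zero. *)
Lemma moment3 (a b g : 'I_d) (p q r : nat) (c ca cb cg : R) :
  (forall s t u : R, s \in [:: -1; 1] -> t \in [:: -1; 1] -> u \in [:: -1; 1] ->
     prob L [set i | [&& X a i == s, X b i == t & X g i == u]]
     = c + s * ca + t * cb + u * cg) ->
  (p + q + r <= 1)%N ->
  \sum_i w i * X a i ^+ p.+1 * X b i ^+ q.+1 * X g i ^+ r.+1
  = moment R p.+1 * moment R q.+1 * moment R r.+1.
Proof.
move=> law deg; rewrite !sum_fibersX //=.
have law' s t u : s \in [:: -1; 1] -> t \in [:: -1; 1] -> u \in [:: -1; 1] ->
    \sum_(i | (X g i == u) && (X b i == t) && (X a i == s)) w i
    = c + s * ca + t * cb + u * cg.
  by move=> ss tt uu; apply: probE; rewrite -(law s t u) //; congr prob;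
     apply/setP => i; rewrite !inE andbC [in LHS](andbC (X g i == u)).
rewrite !law' ?inE ?eqxx ?orbT // /moment.
by move: p q r deg => [|[|p]] [|[|q]] [|[|r]] //= _; field.
Qed.

End Moments.

Theorem proposition23 (R : realType) (L : lattice R 3)
  (supp : forall (a : 'I_3) (i : 'I_(lat_n L).+1),
      vcoord L a i \in [:: -1; 0; 1])
  (hP : forall a b g : 'I_3, a != b -> a != g -> b != g ->
    exists c ca cb cg : R,
      (0 <= c <= 1 / 72) /\
      (- (1 / 72) <= ca <= 1 / 72) /\
      (- (1 / 72) <= cb <= 1 / 72) /\
      (- (1 / 72) <= cg <= 1 / 72) /\
      (* (i) *)
      (prob L [set i | vcoord L a i == 0] = 2 / 3 /\
       prob L [set i | vcoord L a i == 1] = 1 / 6 /\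
       prob L [set i | vcoord L a i == -1] = 1 / 6) /\
      (* (ii) *)
      prob L [set i | (vcoord L a i == 0) && (vcoord L b i == 0)] = 4 / 9 /\
      (* (iii) *)
      (forall sa : R, sa \in [:: -1; 1] ->
         prob L [set i | (vcoord L a i == sa) && (vcoord L b i == 0)] = 1 / 9) /\
      (* (iv) *)
      (forall sa sb : R, sa \in [:: -1; 1] -> sb \in [:: -1; 1] ->
         prob L [set i | (vcoord L a i == sa) && (vcoord L b i == sb)] = 1 / 36) /\
      (* (v) *)
      prob L [set i | [&& vcoord L a i == 0, vcoord L b i == 0 & vcoord L g i == 0]]
        = 1 / 3 - 8 * c /\
      (* (vi) *)
      (forall sa : R, sa \in [:: -1; 1] ->
         prob L [set i | [&& vcoord L a i == sa, vcoord L b i == 0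
                      & vcoord L g i == 0]]
           = 1 / 18 + 4 * c + 4 * sa * ca) /\
      (* (vii) *)
      (forall sa sb : R, sa \in [:: -1; 1] -> sb \in [:: -1; 1] ->
         prob L [set i | [&& vcoord L a i == sa, vcoord L b i == sb
                      & vcoord L g i == 0]]
           = 1 / 36 - 2 * c - 2 * sa * ca - 2 * sb * cb) /\
      (* (viii) *)
      (forall sa sb sg : R,
         sa \in [:: -1; 1] -> sb \in [:: -1; 1] -> sg \in [:: -1; 1] ->
         prob L [set i | [&& vcoord L a i == sa, vcoord L b i == sb
                      & vcoord L g i == sg]]
           = c + sa * ca + sb * cb + sg * cg)) :
  isotropic L (Num.sqrt 3)^-1.
Proof.
pose i0 : 'I_3 := @Ordinal 3 0 isT; pose i1 : 'I_3 := @Ordinal 3 1 isT.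
pose i2 : 'I_3 := @Ordinal 3 2 isT.
(* Each instance of [hP] gives the law of its first coordinate and of its first pair; four orderings
   cover all coordinates and pairs. The joint law of the triple comes from the first one only. *)
have [c [ca [cb [cg [_ [_ [_ [_ [[z0 [p0 n0]] [_ [_ [h01 [_ [_ [_ h]]]]]]]]]]]]]]] :=
  hP i0 i1 i2 isT isT isT.
have [_ [_ [_ [_ [_ [_ [_ [_ [_ [_ [_ [h02 _]]]]]]]]]]]] := hP i0 i2 i1 isT isT isT.
have [_ [_ [_ [_ [_ [_ [_ [_ [[_ [p1 n1]] [_ [_ [h12 _]]]]]]]]]]]] :=
  hP i1 i2 i0 isT isT isT.
have [_ [_ [_ [_ [_ [_ [_ [_ [[_ [p2 n2]] _]]]]]]]]] := hP i2 i0 i1 isT isT isT.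
have mass := total_mass supp z0 p0 n0.
have mom p q r : (p + q + r <= 4)%N ->
    \sum_i weight L i * vcoord L i0 i ^+ p * vcoord L i1 i ^+ q * vcoord L i2 i ^+ r
    = moment R p * moment R q * moment R r.
  (* Eight cases, by which coordinates occur; an absent one contributes the factor [moment R 0],
     which is 1. *)
  case: p q r => [|p] [|q] [|r] deg;
    under eq_bigr do rewrite ?expr0 ?mulr1; rewrite ?mul1r ?mulr1.
  - exact: mass.
  - exact: moment1.
  - exact: moment1.
  - exact: moment2.
  - exact: moment1.
  - exact: moment2.
  - exact: moment2.
  - by apply: (moment3 supp h); lia.
(* A tensor component with index list [s] is the mixed moment whose exponents are the multiplicities
   in [s]. *)
have momS s : (size s <= 4)%N ->
    \sum_i weight L i * \prod_(k <- s) vcoord L k i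
    = moment R (count_mem i0 s) * moment R (count_mem i1 s)
      * moment R (count_mem i2 s).
  have -> : size s = (count_mem i0 s + count_mem i1 s + count_mem i2 s)%N.
    elim: s => //= -[[|[|[|//]]] lt] s ->; rewrite -!val_eqE /=; lia.
  move=> /mom <-; apply: eq_bigr => i _.
  rewrite prodrX_count !big_ord_recl big_ord0 mulr1 !mulrA.
  by congr (_ * vcoord L _ i ^+ count_mem _ s * vcoord L _ i ^+ count_mem _ s
    * vcoord L _ i ^+ count_mem _ s); apply: val_inj.
have cs2 : ((Num.sqrt 3)^-1 : R) ^+ 2 = 1 / 3.
  by rewrite exprVn sqr_sqrtr ?ler0n // mul1r.
have cs4 : ((Num.sqrt 3)^-1 : R) ^+ 4 = 1 / 9.
  by rewrite (exprM _ 2 2) cs2; field.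
split; first by rewrite invr_gt0 sqrtr_gt0 ltr0n.
split=> //; split=> [a|]; last split=> [a b|]; last split=> [a b g|a b g z].
- have := momS [:: a] isT; under eq_bigr do rewrite big_seq1.
  move=> ->.
  by case: a => [[|[|[|//]]] ?] /=; rewrite /moment; field.
- have := momS [:: a; b] isT; under eq_bigr do rewrite !big_cons big_nil mulr1 !mulrA.
  move=> ->; rewrite cs2 /kron.
  by move: a b => [[|[|[|//]]] ?] [[|[|[|//]]] ?]; rewrite /= /moment; field.
- have := momS [:: a; b; g] isT.
  under eq_bigr do rewrite !big_cons big_nil mulr1 !mulrA.
  by move=> ->; move: a b g => [[|[|[|//]]] ?] [[|[|[|//]]] ?] [[|[|[|//]]] ?];
    rewrite /= /moment; field.
- have := momS [:: a; b; g; z] isT.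
  under eq_bigr do rewrite !big_cons big_nil mulr1 !mulrA.
  (* Over all index tuples, the values match because the fourth moment 1/3 is 3 * 1/9 and the
     product of two second moments is 1/9. *)
  move=> ->; rewrite cs4 /kron.
  by move: a b g z =>
    [[|[|[|//]]] ?] [[|[|[|//]]] ?] [[|[|[|//]]] ?] [[|[|[|//]]] ?];
    rewrite /= /moment; field.
Qed.
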